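(* Let $R$ be an arbitrary (possibly non-commutative) ring with $1$, let $n\ge 1$, and let $A\in\mathrm{M}_n(R)$. Then the traces of the product matrices $A^{\ast}A$ and $AA^{\ast}$ are both equal to the symmetric determinant of $A$: $$\mathrm{rdet}_{(1)}(A)=\mathrm{tr}(AA^{\ast})=\mathrm{sdet}(A)=\mathrm{tr}(A^{\ast}A)=\mathrm{ldet}_{(1)}(A).$$
   Context: $\mathrm{S}_n$ is the symmetric group on $\{1,\dots,n\}$ and $\mathrm{tr}$ denotes the sum of the diagonal entries. For $A=[a_{i,j}]\in\mathrm{M}_n(R)$, the symmetric determinant is $$\mathrm{sdet}(A)=\sum_{\alpha,\beta\in\mathrm{S}_n}\mathrm{sgn}(\alpha)\,\mathrm{sgn}(\beta)\,a_{\alpha(1),\beta(1)}a_{\alpha(2),\beta(2)}\cdots a_{\alpha(n),\beta(n)}.$$ The preadjoint matrix $A^{\ast}=[a^{\ast}_{r,s}]\in\mathrm{M}_n(R)$ is defined by $$a^{\ast}_{r,s}=\sum_{\alpha,\beta}\mathrm{sgn}(\alpha)\,\mathrm{sgn}(\beta)\,a_{\alpha(1),\beta(1)}\cdots a_{\alpha(s-1),\beta(s-1)}\,a_{\alpha(s+1),\beta(s+1)}\cdots a_{\alpha(n),\beta(n)},$$ where the sum is over all $\alpha,\beta\in\mathrm{S}_n$ with $\alpha(s)=s$ and $\beta(s)=r$ (an empty product is $1$). The first right determinant and the first left determinant of $A$ are defined by $\mathrm{rdet}_{(1)}(A)=\mathrm{tr}(AA^{\ast})$ and $\mathrm{ldet}_{(1)}(A)=\mathrm{tr}(A^{\ast}A)$.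 *)

(* Defs.v *)
From mathcomp Require Import all_boot all_order all_algebra all_fingroup.
Set Implicit Arguments.
Unset Strict Implicit.
Unset Printing Implicit Defensive.
Import GRing.Theory.
Local Open Scope ring_scope.

(* The ring R need not be commutative: the products below are taken in
   increasing order of the index k, as 'I_n is enumerated.  Indices run from
   0 to n.-1 instead of 1 to n.  A [pzRingType] may be the zero ring. *)

Definition sdet (R : pzRingType) (n : nat) (A : 'M[R]_n) : R :=
  \sum_(alpha : 'S_n) \sum_(beta : 'S_n)
    (-1) ^+ alpha * (-1) ^+ beta * \prod_(k < n) A (alpha k) (beta k).

Definition preadj (R : pzRingType) (n : nat) (A : 'M[R]_n) : 'M[R]_n :=
  \matrix_(r < n, s < n)
    \sum_(alpha : 'S_n | alpha s == s) \sum_(beta : 'S_n | beta s == r)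
      (-1) ^+ alpha * (-1) ^+ beta *
        \prod_(k < n | k != s) A (alpha k) (beta k).

Definition rdet1 (R : pzRingType) (n : nat) (A : 'M[R]_n) : R :=
  \tr (A *m preadj A).

Definition ldet1 (R : pzRingType) (n : nat) (A : 'M[R]_n) : R :=
  \tr (preadj A *m A).

(* Main.v *)
Require Import Defs.
From mathcomp Require Import all_boot all_order all_algebra all_fingroup.
Set Implicit Arguments.
Unset Strict Implicit.
Unset Printing Implicit Defensive.
Import GRing.Theory.
Local Open Scope ring_scope.

(** A term of [sdet A] is a pair of permutations together with an ordered
    product of [n] factors, and precomposing both permutations with the same
    [sigma] multiplies the two signs by the square of the sign of [sigma], that
    is, by 1.  So the factors may be rearranged by any common [sigma], and
    [sigma] may even depend on the term, provided that the substitution remains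
    a bijection.

    Fix a position [p], and sort the terms by the row index [s] of the factor in
    position [p].  In the class of [s], take for [sigma] the cycle that sends
    [p] to [s] and preserves the order of the other indices.  The class becomes
    the set of all pairs whose first permutation fixes [s], and the product now
    reads its factors in increasing order except for factor [s], which sits in
    position [p] ([sdet_expand]).  When [p] is the first (resp. last) position,
    factor [s] stands in front of (resp. behind) the ordered product of the
    others.  This is what the trace of [A *m preadj A] (resp. [preadj A *m A])
    expands to, because the defining sum of its [(r, s)] entry omits factor [s]
    from the product, and the remaining sum over [r] amounts to letting the
    second permutation be arbitrary. *)

(** Commutativity is not available to isolate index [s], so the equality is
    one of index sequences: [lift s] enumerates the indices other than [s] in
    increasing order. *)
Lemma big_neq_lift (T : Type) (idx : T) (op : T -> T -> T) (m : nat)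
    (s : 'I_m.+1) (F : 'I_m.+1 -> T) :
  \big[op/idx]_(k < m.+1 | k != s) F k = \big[op/idx]_(j < m) F (lift s j).
Proof.
rewrite -big_filter -(big_map (lift s) xpredT); congr bigop.
rewrite /index_enum !locked_withE -!enumT.
have sorted_ord q : sorted (fun i j : 'I_q => (i < j)%N) (enum 'I_q).
  by have := iota_ltn_sorted 0 q; rewrite -val_enum_ord sorted_map.
apply: (@irr_sorted_eq _ (fun i j : 'I_m.+1 => (i < j)%N)).
- by move=> x y z; apply: ltn_trans.
- by move=> x; apply: ltnn.
- by apply: sorted_filter (sorted_ord _) => x y z; apply: ltn_trans.
- rewrite sorted_map; apply: sub_sorted (sorted_ord m) => i j /= lt_ij.
  by rewrite ltnNge leq_bump2 -ltnNge.
move=> k; rewrite mem_filter mem_enum andbT.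
apply/idP/mapP => [|[j _ ->]]; last by rewrite eq_sym neq_lift.
by rewrite eq_sym => /unlift_some[j -> _]; exists j; rewrite ?mem_enum.
Qed.

Lemma sign_mulg_pair (R : pzRingType) (n : nat) (sigma alpha beta : 'S_n) :
  (-1) ^+ (sigma * alpha)%g * (-1) ^+ (sigma * beta)%g
    = (-1) ^+ alpha * (-1) ^+ beta :> R.
Proof. by rewrite -!signr_addb !odd_permM addbACA addbb. Qed.

(** The permutation [lift_perm p s 1] is the order-preserving cycle that moves
    position [p] to [s]; precomposition with it turns the condition
    [alpha p = s] into [alpha s = s]. *)
Lemma sdet_expand (R : pzRingType) (m : nat) (A : 'M[R]_m.+1) (p : 'I_m.+1) :
  sdet A = \sum_s \sum_(alpha : 'S_m.+1 | alpha s == s) \sum_(beta : 'S_m.+1)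
    (-1) ^+ alpha * (-1) ^+ beta *
      \prod_k A (alpha (lift_perm p s 1 k)) (beta (lift_perm p s 1 k)).
Proof.
rewrite /sdet (partition_big (fun alpha : 'S_m.+1 => alpha p) xpredT) //=.
apply: eq_bigr => s _.
rewrite (reindex_inj (mulgI (lift_perm p s 1))) /=.
apply: eq_big => [alpha | alpha _]; first by rewrite permM lift_perm_id.
rewrite (reindex_inj (mulgI (lift_perm p s 1))) /=; apply: eq_bigr => beta _.
by rewrite sign_mulg_pair; congr (_ * _); apply: eq_bigr => k _; rewrite !permM.
Qed.

Lemma trace_mul_preadj (R : pzRingType) (n : nat) (A : 'M[R]_n) :
  \tr (A *m preadj A) =
    \sum_s \sum_(alpha : 'S_n | alpha s == s) \sum_(beta : 'S_n)
      (-1) ^+ alpha * (-1) ^+ beta *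
        (A s (beta s) * \prod_(k < n | k != s) A (alpha k) (beta k)).
Proof.
apply: eq_bigr => s _; rewrite mxE.
under eq_bigr do rewrite mxE mulr_sumr.
rewrite exchange_big /=; apply: eq_bigr => alpha _.
rewrite [RHS](partition_big (fun beta : 'S_n => beta s) xpredT) //=.
apply: eq_bigr => r _; rewrite mulr_sumr; apply: eq_bigr => beta /eqP->.
by rewrite -signr_addb mulrA commr_sign -mulrA.
Qed.

Lemma trace_preadj_mul (R : pzRingType) (n : nat) (A : 'M[R]_n) :
  \tr (preadj A *m A) =
    \sum_s \sum_(alpha : 'S_n | alpha s == s) \sum_(beta : 'S_n)
      (-1) ^+ alpha * (-1) ^+ beta *
        (\prod_(k < n | k != s) A (alpha k) (beta k) * A s (beta s)).
Proof.
rewrite /mxtrace; under eq_bigr do rewrite mxE.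
rewrite exchange_big /=; apply: eq_bigr => s _.
under eq_bigr do rewrite mxE mulr_suml.
rewrite exchange_big /=; apply: eq_bigr => alpha _.
rewrite [RHS](partition_big (fun beta : 'S_n => beta s) xpredT) //=.
apply: eq_bigr => r _; rewrite mulr_suml; apply: eq_bigr => beta /eqP->.
by rewrite mulrA.
Qed.

Lemma trace_mul_preadj_sdet (R : pzRingType) (m : nat) (A : 'M[R]_m.+1) :
  \tr (A *m preadj A) = sdet A.
Proof.
rewrite trace_mul_preadj (sdet_expand A ord0); apply: eq_bigr => s _.
apply: eq_bigr => alpha /eqP alpha_s; apply: eq_bigr => beta _.
rewrite big_ord_recl lift_perm_id alpha_s big_neq_lift.
by under [in RHS]eq_bigr do rewrite lift_perm_lift perm1.
Qed.

Lemma trace_preadj_mul_sdet (R : pzRingType) (m : nat) (A : 'M[R]_m.+1) :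
  \tr (preadj A *m A) = sdet A.
Proof.
rewrite trace_preadj_mul (sdet_expand A ord_max); apply: eq_bigr => s _.
apply: eq_bigr => alpha /eqP alpha_s; apply: eq_bigr => beta _.
rewrite big_ord_recr lift_perm_id alpha_s big_neq_lift /=.
have widenE (j : 'I_m) : widen_ord (leqnSn m) j = lift ord_max j.
  by apply/val_inj/esym/lift_max.
by under [in RHS]eq_bigr do rewrite widenE lift_perm_lift perm1.
Qed.

Theorem theorem5p1 (R : pzRingType) (n : nat) (hn : (1 <= n)%N) (A : 'M[R]_n) :
  [/\ rdet1 A = \tr (A *m preadj A),
      \tr (A *m preadj A) = sdet A,
      sdet A = \tr (preadj A *m A)
    & \tr (preadj A *m A) = ldet1 A].
Proof.
case: n hn A => // m _ A.
by split=> //; rewrite ?trace_mul_preadj_sdet ?trace_preadj_mul_sdet.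
Qed.
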